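(* Let $M,N\ge 1$ be integers, let $P,\sigma^2,\beta_1,\beta_2,\alpha_{\max}>0$ be real numbers, let $\mathbf{h}_3\in\mathbb{C}^M$, and let $\mathbf{a}_{2,1}\in\mathbb{C}^M$ have unit-modulus entries. For $r=(r_1,\dots,r_N)\in[0,\alpha_{\max}]^N$ define $$\mathrm{SNR}(r)=\frac{PM\beta_1\beta_2\left(\sum_{n=1}^N r_n\right)^2-P\beta_2\left(\sum_{n=1}^N r_n^2\right)|\mathbf{h}_3^{H}\mathbf{a}_{2,1}|^2+2P\sqrt{\beta_1\beta_2}\,|\mathbf{h}_3^{H}\mathbf{a}_{2,1}|\sum_{n=1}^N r_n}{\sigma^2\left(1+\beta_2M\sum_{n=1}^N r_n^2\right)}+\frac{P\|\mathbf{h}_3\|^2}{\sigma^2}.$$ Then $\mathrm{SNR}$ is maximized over $[0,\alpha_{\max}]^N$ at a point where all amplitudes are identical, $r_n=\alpha$ for all $n$. With $r_n=\alpha$ for all $n$, the SNR equals $$\frac{\mathcal{A}\alpha^2+\mathcal{B}\alpha}{\sigma^2+\mathcal{C}\alpha^2}+\frac{P\|\mathbf{h}_3\|^2}{\sigma^2},$$ where $$\mathcal{A}=PM\beta_1\beta_2N^2-P\beta_2N|\mathbf{h}_3^{H}\mathbf{a}_{2,1}|^2,\quad \mathcal{B}=2PN\sqrt{\beta_1\beta_2}\,|\mathbf{h}_3^{H}\mathbf{a}_{2,1}|,\quad \mathcal{C}=\sigma^2\beta_2MN.$$ Moreover, the optimal common amplitude is $$\alpha=\begin{cases}\alpha_{\max},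 & \text{if } |\mathbf{h}_3^{H}\mathbf{a}_{2,1}|=0,\\ \min(\alpha^\star,\alpha_{\max}), & \text{otherwise,}\end{cases}\qquad \alpha^\star=\frac{\mathcal{A}\sigma^2+\sqrt{\mathcal{A}^2\sigma^4+\mathcal{B}^2\mathcal{C}\sigma^2}}{\mathcal{B}\mathcal{C}}.$$
   Context: Here $(\cdot)^H$ is the conjugate transpose and $\|\cdot\|$ the Euclidean norm. The function $\mathrm{SNR}(r)$ is the signal-to-noise ratio of an uplink assisted by an active reconfigurable intelligent surface (RIS) with $N$ elements, an $M$-antenna base station and a direct user–base-station channel $\mathbf{h}_3$, after the RIS phases have been optimized; $r_n$ is the amplitude gain of element $n$, and $\alpha_{\max}$ is the maximum amplitude gain of an element. *)

(* Defs.v *)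
From mathcomp Require Import all_boot all_order all_algebra.
From mathcomp Require Import complex reals.

Set Implicit Arguments.
Unset Strict Implicit.
Unset Printing Implicit Defensive.

Import Order.TTheory GRing.Theory Num.Theory.

Local Open Scope ring_scope.
Local Open Scope complex_scope.
Local Open Scope sesquilinear_scope.

(* The library norm `|z| of z : R[i] is itself an element of R[i] (with zero
   imaginary part); Normc.normc z is the same modulus as an element of R. *)
Notation cmod := Normc.normc.

Definition l2norm (R : realType) (M : nat) (h : 'cV[R[i]]_M) : R :=
  Num.sqrt (\sum_(m < M) cmod (h m 0) ^+ 2).

(* h^H a; the product is a 1 x 1 matrix. *)
Definition hprod (R : realType) (M : nat) (h a : 'cV[R[i]]_M) : R[i] :=
  (h ^t* *m a) 0 0.

Definition is_argmax (R : realType) (T : Type) (f : T -> R) (D : T -> Prop)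
    (x : T) : Prop :=
  D x /\ forall y, D y -> f y <= f x.

Definition gain_box (R : realType) (N : nat) (amax : R) (r : 'rV[R]_N) : Prop :=
  forall n, 0 <= r 0 n <= amax.

Section SNR.
Variables (R : realType) (M N : nat).
(* sigma2 stands for the noise power sigma^2, so sigma^4 is sigma2 ^+ 2. *)
Variables (P sigma2 beta1 beta2 : R) (h3 a21 : 'cV[R[i]]_M).

Let g : R := cmod (hprod h3 a21).

Definition SNR (r : 'rV[R]_N) : R :=
  (P * M%:R * beta1 * beta2 * (\sum_(n < N) r 0 n) ^+ 2
     - P * beta2 * (\sum_(n < N) r 0 n ^+ 2) * g ^+ 2
     + 2%:R * P * Num.sqrt (beta1 * beta2) * g * \sum_(n < N) r 0 n)
  / (sigma2 * (1 + beta2 * M%:R * \sum_(n < N) r 0 n ^+ 2))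
  + P * l2norm h3 ^+ 2 / sigma2.

Definition snrA : R :=
  P * M%:R * beta1 * beta2 * N%:R ^+ 2 - P * beta2 * N%:R * g ^+ 2.

Definition snrB : R := 2%:R * P * N%:R * Num.sqrt (beta1 * beta2) * g.

Definition snrC : R := sigma2 * beta2 * M%:R * N%:R.

Definition alpha_star : R :=
  (snrA * sigma2
     + Num.sqrt (snrA ^+ 2 * sigma2 ^+ 2 + snrB ^+ 2 * snrC * sigma2))
  / (snrB * snrC).

Definition alpha_opt (amax : R) : R :=
  if g == 0 then amax else Num.min alpha_star amax.

End SNR.

(* Main.v *)
(** The numerator of the SNR increases with the sum of the gains and the rest
    depends only on the sum of their squares.  By Cauchy-Schwarz, replacing all
    gains by their root mean square therefore does not decrease the SNR.  The
    remaining problem is to maximize (A x^2 + B x) / (s + C x^2); its increments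
    factor as (a - x) times a function of x that is affine for fixed a, so the
    sign of an increment can be read off at x = 0 and x = a. *)

Require Import Defs.
From mathcomp Require Import all_boot all_order all_algebra.
From mathcomp Require Import complex reals.
From mathcomp Require Import ring lra.

Set Implicit Arguments.
Unset Strict Implicit.
Unset Printing Implicit Defensive.

Import Order.TTheory GRing.Theory Num.Theory.

Local Open Scope ring_scope.
Local Open Scope complex_scope.

(** The squared deviations of [N * x n] from the sum [S] add up to [N * (N * Q - S ^+ 2)].
    Cancelling the factor [N] requires it to be positive, so the empty sum is split off. *)
Lemma sqr_sum_le (R : realFieldType) (N : nat) (x : 'I_N -> R) :
  (\sum_(n < N) x n) ^+ 2 <= N%:R * \sum_(n < N) x n ^+ 2.
Proof.
case: N x => [|N] x; first by rewrite !big_ord0 expr0n mulr0.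
set S := \sum_(n < _) x n; set Q := \sum_(n < _) x n ^+ 2.
have N0 : 0 < N.+1%:R :> R by rewrite ltr0n.
have : 0 <= \sum_(n < N.+1) (N.+1%:R * x n - S) ^+ 2.
  by apply: sumr_ge0 => n _; exact: sqr_ge0.
have -> : \sum_(n < N.+1) (N.+1%:R * x n - S) ^+ 2
    = N.+1%:R * (N.+1%:R * Q - S ^+ 2).
  have dev n : (N.+1%:R * x n - S) ^+ 2
      = N.+1%:R ^+ 2 * x n ^+ 2 - 2 * N.+1%:R * S * x n + S ^+ 2 by ring.
  rewrite (eq_bigr _ (fun n _ => dev n)) big_split sumrB /= -!mulr_sumr -/S -/Q.
  rewrite sumr_const card_ord -(mulr_natl S); ring.
by rewrite pmulr_rge0 // subr_ge0.
Qed.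

Lemma sum_const_mx (R : pzSemiRingType) (N : nat) (a : R) (F : R -> R) :
  \sum_(n < N) F ((const_mx a : 'rV_N) 0 n) = N%:R * F a.
Proof.
by under eq_bigr do rewrite mxE; rewrite sumr_const card_ord mulr_natl.
Qed.

Section ScalarProblem.
Variables (R : rcfType) (s A B C : R).
Hypotheses (s0 : 0 < s) (C0 : 0 < C).

Let f (x : R) := (A * x ^+ 2 + B * x) / (s + C * x ^+ 2).
Let root := (A * s + Num.sqrt (A ^+ 2 * s ^+ 2 + B ^+ 2 * C * s)) / (B * C).

(** After cross-multiplying by the positive denominators the [A * C] terms cancel and [a - x]
    factors out. This serves both [B = 0] and [0 < B]. *)
Lemma quadratic_ratio_ltE (a x : R) :
  (f x < f a) = (0 < (a - x) * (A * s * (a + x) + B * s - B * C * a * x)).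
Proof.
have den_gt0 y : 0 < s + C * y ^+ 2.
  by rewrite ltr_pwDl // mulr_ge0 ?sqr_ge0 ?ltW.
rewrite /f ltr_pdivrMr // mulrAC ltr_pdivlMr // -subr_gt0.
by congr (0 < _); ring.
Qed.

Hypothesis B0 : 0 < B.

(** The square root strictly exceeds [|A * s|], so the numerator is positive even for negative
    [A]. *)
Lemma quadratic_root_gt0 : 0 < root.
Proof.
rewrite divr_gt0 ?mulr_gt0 // -ltrBlDl sub0r.
apply: le_lt_trans (ler_norm _) _.
rewrite normrN -sqrtr_sqr ltr_sqrt; last first.
  by rewrite ltr_wpDl ?mulr_gt0 ?exprn_gt0 // mulr_ge0 ?sqr_ge0.
by rewrite exprMn ltrDl !mulr_gt0 ?exprn_gt0.
Qed.

(** Up to sign, this quadratic is the numerator of the derivative of [f], so [root] is a critical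
    point. Multiplying by [B * C] completes the square. *)
Lemma quadratic_root_eq : B * C * root ^+ 2 - 2 * A * s * root - B * s = 0.
Proof.
set D := A ^+ 2 * s ^+ 2 + B ^+ 2 * C * s.
have D0 : 0 <= D.
  have [s1 C1] := (ltW s0, ltW C0).
  by rewrite /D -exprMn addr_ge0 ?sqr_ge0 // -mulrA mulr_ge0 ?sqr_ge0 ?mulr_ge0.
have BC0 : B * C != 0 by rewrite mulf_neq0 ?gt_eqF.
have E : B * C * root = A * s + Num.sqrt D by rewrite mulrC divfK.
apply: (mulfI BC0); rewrite mulr0.
have -> : B * C * (B * C * root ^+ 2 - 2 * A * s * root - B * s)
    = (B * C * root - A * s) ^+ 2 - D by rewrite /D; ring.
by rewrite E (addrC (A * s)) addrK sqr_sqrtr // subrr.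
Qed.

Lemma quadratic_root_le0 (a : R) : 0 <= a <= root ->
  B * C * a ^+ 2 - 2 * A * s * a - B * s <= 0.
Proof.
case/andP=> a0 ar; have r0 := quadratic_root_gt0.
rewrite -(pmulr_rle0 _ r0).
(* The roots of the quadratic have product [- s / C], so the other root is negative; up to a
   positive constant, [B * C * a * root + B * s] is its linear factor. *)
have -> : root * (B * C * a ^+ 2 - 2 * A * s * a - B * s)
    = - (root - a) * (B * C * a * root + B * s)
      + a * (B * C * root ^+ 2 - 2 * A * s * root - B * s) by ring.
rewrite quadratic_root_eq mulr0 addr0 mulNr oppr_le0 mulr_ge0 ?subr_ge0 //.
have [B1 s1] := (ltW B0, ltW s0).
exact: addr_ge0 (mulr_ge0 (mulr_ge0 (mulr_ge0 B1 (ltW C0)) a0) (ltW r0))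
  (mulr_ge0 B1 s1).
Qed.

Lemma quadratic_ratio_max (m x : R) : 0 < m -> 0 <= x <= m ->
  x != Num.min root m -> f x < f (Num.min root m).
Proof.
move=> m0 /andP[x0 xm]; set a := Num.min root m => xa.
have r0 := quadratic_root_gt0.
have a0 : 0 < a by rewrite lt_min r0.
have qa : B * C * a ^+ 2 - 2 * A * s * a - B * s <= 0.
  by apply: quadratic_root_le0; rewrite ltW //= ge_min lexx.
have L0 : 0 < A * s * a + B * s.
  (* By [qa], twice the goal's right-hand side is at least this positive quantity. *)
  have : 0 < B * C * a ^+ 2 + B * s by rewrite addr_gt0 ?mulr_gt0 ?exprn_gt0.
  lra.
rewrite quadratic_ratio_ltE -(pmulr_rgt0 _ a0).
(* The affine factor is interpolated between its values at [0] and at [a]: the former is [L0], the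
   latter is minus the quadratic of [qa]. *)
have -> : a * ((a - x) * (A * s * (a + x) + B * s - B * C * a * x))
    = (a - x) ^+ 2 * (A * s * a + B * s)
      - (a - x) * x * (B * C * a ^+ 2 - 2 * A * s * a - B * s) by ring.
have sq0 : 0 < (a - x) ^+ 2 by rewrite exprn_even_gt0 //= subr_eq0 eq_sym.
apply: ltr_pwDl; first exact: mulr_gt0.
case: (ltrP x a) => [xla | ax].
  by rewrite -mulrN mulr_ge0 ?oppr_ge0 // mulr_ge0 // subr_ge0 ltW.
(* A point beyond [a] exists only if the cap [m] is inactive; then [a] is [root] and the second term
   vanishes. *)
have {}ax : a < x by rewrite lt_neqAle eq_sym xa.
have -> : a = root.
  rewrite /a minEle; case: ifP => // /negbT; rewrite -ltNge => mr.
  by move: ax; rewrite /a (min_idPr (ltW mr)) ltNge xm.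
by rewrite quadratic_root_eq mulr0 oppr0.
Qed.

End ScalarProblem.

Section CommonGain.
Variables (R : realType) (M N : nat).
Variables (P sigma2 beta1 beta2 : R) (h3 a21 : 'cV[R[i]]_M).
Hypotheses (P0 : 0 < P) (sigma2_gt0 : 0 < sigma2) (beta2_gt0 : 0 < beta2).

Let snr := @SNR R M N P sigma2 beta1 beta2 h3 a21.
Let A := snrA N P beta1 beta2 h3 a21.
Let B := snrB N P beta1 beta2 h3 a21.
Let C := snrC M N sigma2 beta2.

Lemma cmod_ge0 (z : R[i]) : 0 <= cmod z.
Proof. by case: z => u v; exact: sqrtr_ge0. Qed.

Lemma SNR_const (alpha : R) : snr (const_mx alpha)
  = (A * alpha ^+ 2 + B * alpha) / (sigma2 + C * alpha ^+ 2)
    + P * l2norm h3 ^+ 2 / sigma2.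
Proof.
rewrite /snr /SNR; congr (_ + _).
rewrite (sum_const_mx _ _ id) (sum_const_mx _ _ (fun x => x ^+ 2)).
rewrite /A /B /C /snrA /snrB /snrC.
by congr (_ / _); ring.
Qed.

Lemma SNR_le_rms (amax : R) (r : 'rV[R]_N) : (0 < N)%N -> 0 <= beta1 ->
  gain_box amax r ->
  exists2 alpha, 0 <= alpha <= amax & snr r <= snr (const_mx alpha).
Proof.
move=> N0 b1 hr; have NR0 : 0 < N%:R :> R by rewrite ltr0n.
have amax0 : 0 <= amax.
  by have /andP[h1 h2] := hr (Ordinal N0); exact: le_trans h1 h2.
set Q := \sum_(n < N) r 0 n ^+ 2; set S := \sum_(n < N) r 0 n.
have Q0 : 0 <= Q by apply: sumr_ge0 => n _; exact: sqr_ge0.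
have S0 : 0 <= S by apply: sumr_ge0 => n _; case/andP: (hr n).
(* The root mean square preserves [Q], hence the denominator and the subtracted term; only the terms
   increasing in [S] are left to compare. *)
set alpha := Num.sqrt (Q / N%:R).
have alpha2 : N%:R * alpha ^+ 2 = Q.
  by rewrite sqr_sqrtr ?divr_ge0 ?ler0n // mulrC divfK ?gt_eqF.
have alpha0 : 0 <= alpha by exact: sqrtr_ge0.
exists alpha.
  rewrite alpha0 -(@ler_pXn2r _ 2) ?nnegrE // -(ler_pM2l NR0) alpha2.
  have -> : N%:R * amax ^+ 2 = \sum_(n < N) amax ^+ 2.
    by rewrite sumr_const card_ord mulr_natl.
  apply: ler_sum => n _; have /andP[h1 h2] := hr n.
  by rewrite ler_pXn2r ?nnegrE.
have SN : S <= N%:R * alpha.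
  rewrite -(@ler_pXn2r _ 2) ?nnegrE ?mulr_ge0 ?ler0n //.
  by rewrite exprMn (expr2 N%:R) -mulrA alpha2; exact: sqr_sum_le.
rewrite /snr /SNR (sum_const_mx _ _ id) (sum_const_mx _ _ (fun x => x ^+ 2)).
rewrite alpha2 -/S -/Q lerD2r ler_pM2r; last first.
  rewrite invr_gt0 mulr_gt0 // ltr_pwDl // mulr_ge0 // mulr_ge0 //.
  exact: ltW.
have [P1 b2] := (ltW P0, ltW beta2_gt0).
apply: lerD; last by rewrite ler_wpM2l // !mulr_ge0 ?sqrtr_ge0 ?cmod_ge0.
rewrite lerD2r ler_wpM2l ?mulr_ge0 //.
by rewrite ler_pXn2r ?nnegrE // mulr_ge0 ?ler0n.
Qed.

(** Strictness is what later makes the optimal common gain unique. *)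
Lemma SNR_const_lt_opt (amax alpha : R) : (0 < M)%N -> (0 < N)%N ->
  0 < beta1 -> 0 < amax -> 0 <= alpha <= amax ->
  let opt := alpha_opt N P sigma2 beta1 beta2 h3 a21 amax in
  alpha != opt -> snr (const_mx alpha) < snr (const_mx opt).
Proof.
move=> M0 N0 b1 m0 bnd /=.
have MR0 : 0 < M%:R :> R by rewrite ltr0n.
have NR0 : 0 < N%:R :> R by rewrite ltr0n.
have C0 : 0 < C by rewrite /C /snrC !mulr_gt0.
rewrite !SNR_const ltrD2r /alpha_opt; case: ifPn => [/eqP g0 | g0] neq.
  (* Here [alpha_star] would divide by zero. The ratio reduces to
     [A * x ^+ 2 / (sigma2 + C * x ^+ 2)] with [0 < A], strictly increasing for nonnegative [x], so
     the cap is optimal. *)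
  have B0 : B = 0 by rewrite /B /snrB g0 mulr0.
  have A0 : 0 < A.
    by rewrite /A /snrA g0 expr0n mulr0 subr0 !mulr_gt0 ?exprn_gt0.
  have /andP[a0 am] := bnd.
  rewrite quadratic_ratio_ltE // B0 !mul0r addr0 subr0.
  have am' : 0 < amax - alpha by rewrite subr_gt0 lt_neqAle neq.
  by rewrite !mulr_gt0 // ltr_wpDr.
apply: quadratic_ratio_max => //.
rewrite /B /snrB !mulr_gt0 ?sqrtr_gt0 ?mulr_gt0 //.
by rewrite lt_neqAle eq_sym g0 cmod_ge0.
Qed.

Lemma alpha_opt_bounds (amax : R) : (0 < M)%N -> (0 < N)%N ->
  0 < beta1 -> 0 < amax ->
  0 <= alpha_opt N P sigma2 beta1 beta2 h3 a21 amax <= amax.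
Proof.
move=> M0 N0 b1 m0; have MR0 : 0 < M%:R :> R by rewrite ltr0n.
have NR0 : 0 < N%:R :> R by rewrite ltr0n.
rewrite /alpha_opt; case: ifPn => [_ | g0]; first by rewrite ltW /=.
rewrite ge_min lexx orbT andbT le_min (ltW m0) andbT ltW //.
apply: quadratic_root_gt0 => //; first by rewrite /snrC !mulr_gt0.
rewrite /snrB !mulr_gt0 ?sqrtr_gt0 ?mulr_gt0 //.
by rewrite lt_neqAle eq_sym g0 cmod_ge0.
Qed.

End CommonGain.

Theorem theorem1 (R : realType) (M N : nat) (hM : (1 <= M)%N) (hN : (1 <= N)%N)
    (P sigma2 beta1 beta2 amax : R)
    (hP : 0 < P) (hsigma2 : 0 < sigma2) (hbeta1 : 0 < beta1)
    (hbeta2 : 0 < beta2) (hamax : 0 < amax)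
    (h3 a21 : 'cV[R[i]]_M) (ha21 : forall m : 'I_M, cmod (a21 m 0) = 1) :
  let snr := @SNR R M N P sigma2 beta1 beta2 h3 a21 in
  let A := snrA N P beta1 beta2 h3 a21 in
  let B := snrB N P beta1 beta2 h3 a21 in
  let C := snrC M N sigma2 beta2 in
  [/\ exists alpha : R, is_argmax snr (gain_box amax) (const_mx alpha),
      forall alpha : R, 0 <= alpha <= amax ->
        snr (const_mx alpha)
          = (A * alpha ^+ 2 + B * alpha) / (sigma2 + C * alpha ^+ 2)
            + P * l2norm h3 ^+ 2 / sigma2
    & forall alpha : R,
        is_argmax snr (gain_box amax) (const_mx alpha) <->
        alpha = alpha_opt N P sigma2 beta1 beta2 h3 a21 amax].
Proof.
move=> snr A B C; set opt := alpha_opt _ _ _ _ _ _ _ _.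
have optP : 0 <= opt <= amax by exact: alpha_opt_bounds.
have opt_box : gain_box amax (const_mx opt : 'rV_N) by move=> n; rewrite mxE.
have opt_max : is_argmax snr (gain_box amax) (const_mx opt).
  split=> // r r_box.
  have [alpha bnd /le_trans] := SNR_le_rms h3 a21 hP hsigma2 hbeta2 hN
    (ltW hbeta1) r_box.
  apply; have [-> // | neq] := eqVneq alpha opt.
  by apply: ltW; exact: SNR_const_lt_opt.
split; [by exists opt | by move=> alpha _; exact: SNR_const | move=> alpha].
split=> [[box_alpha max_alpha] | -> //].
have bnd : 0 <= alpha <= amax by have := box_alpha (Ordinal hN); rewrite mxE.
(* Any other common gain in the box loses strictly to [opt], so it cannot be a maximizer. *)
apply/eqP/negPn/negP => neq.
have := max_alpha _ opt_box; rewrite leNgt => /negP; apply.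
exact: SNR_const_lt_opt.
Qed.
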